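(* Let $\mathcal{S}=\{\varrho_1,\dots,\varrho_N\}$ be a family of $N\ge1$ density operators on $\mathbb{C}^D$. Then the geometric rugosity of $\mathcal S$, $$\mathfrak{R}_G(\mathcal S):=-\ln\left[\max_U\left(\prod_{a=1}^N\frac{\Sigma_U(\varrho_a)}{D}\right)^{1/N}\right],$$ satisfies $$\mathfrak{R}_G(\mathcal S)=\min_U\frac1N\sum_{a=1}^N\mathfrak{R}_U(\varrho_a),$$ where both extrema are over all $D\times D$ unitary matrices $U$.
   Context: Let $|f_1\rangle=\frac1{\sqrt D}\sum_{j=1}^D|j\rangle$ in the standard basis of $\mathbb{C}^D$. For a unitary $U$ and a density operator $\varrho$ on $\mathbb{C}^D$, the grand sum of $\varrho$ in the basis selected by $U$ is $\Sigma_U(\varrho)=D\,\langle f_1|U\varrho U^\dagger|f_1\rangle\in[0,D]$ (in particular $\Sigma_U(\varrho)\ge0$ always), and the rugosity in that basis is $\mathfrak{R}_U(\varrho)=-\ln\frac{\Sigma_U(\varrho)}{D}$, with the convention $-\ln 0=+\infty$. *)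

(* Defs.v *)
From mathcomp Require Export all_boot all_order all_algebra.
From mathcomp Require Export sesquilinear spectral complex.
From mathcomp Require Export all_classical all_reals all_analysis.

Set Implicit Arguments.
Unset Strict Implicit.
Unset Printing Implicit Defensive.

Import Order.TTheory GRing.Theory Num.Theory.
Local Open Scope classical_set_scope.
Local Open Scope ring_scope.
Local Open Scope sesquilinear_scope.
Local Open Scope complex_scope.

Section rugosity.
Variables (R : realType) (D : nat).
Local Notation C := R[i].
Implicit Types (U A rho : 'M[C]_D) (u v : 'cV[C]_D).

(* <u|A|v> *)
Definition braket u A v : C := (u^t* *m A *m v) 0 0.

(* On C, [0 <= z] means that z is real and nonnegative. *)
Definition density_operator rho : Prop :=
  [/\ rho \is hermsymmx,
      forall v, 0 <= braket v rho v &
      \tr rho = 1].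

(* The column [delta_mx j 0] is the basis vector |j>. *)
Definition f1 : 'cV[C]_D :=
  ((Num.sqrt D%:R)^-1)%:C *: \sum_(j < D) delta_mx j 0.

(* Taking the real part loses nothing on density operators: see
   [grand_sumE] below. *)
Definition grand_sum U rho : R :=
  D%:R * complex.Re (braket f1 (U *m rho *m U^t*) f1).

Lemma grand_sumE U rho : density_operator rho ->
  (grand_sum U rho)%:C = D%:R * braket f1 (U *m rho *m U^t*) f1 /\
  0 <= grand_sum U rho.
Proof.
case=> _ rho_ge0 _.
have b_ge0 : 0 <= braket f1 (U *m rho *m U^t*) f1.
  have := rho_ge0 (U^t* *m f1).
  by rewrite /braket trmx_mul map_mxM /= trmxCK !mulmxA.
move: b_ge0; rewrite /grand_sum; case: braket => a b /=.
rewrite lecE /= => /andP[/eqP -> a_ge0]; split; last exact: mulr_ge0.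
by rewrite rmorphM /= rmorph_nat.
Qed.

(* [lne 0 = -oo], hence the value is [+oo] when the grand sum vanishes. *)
Definition rugosity U rho : \bar R := (- lne (grand_sum U rho / D%:R)%:E)%E.

Variable N : nat.
Implicit Type S : 'I_N -> 'M[C]_D.

Definition geometric_mean S U : R :=
  (\prod_(a < N) (grand_sum U (S a) / D%:R)) `^ (N%:R^-1).

Definition average_rugosity S U : \bar R :=
  ((N%:R^-1)%:E * \sum_(a < N) rugosity U (S a))%E.

Definition unitaries : set 'M[C]_D := [set U | U \is unitarymx].

(* The maximum over the unitary group is written as a supremum; this is only
   meaningful once the supremum is known to be attained. *)
Definition geometric_rugosity S : \bar R :=
  (- lne (sup [set geometric_mean S U | U in unitaries])%:E)%E.

End rugosity.

Arguments f1 : clear implicits.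
Arguments unitaries : clear implicits.

(* Main.v *)
Require Import Defs.
Set Implicit Arguments.
Unset Strict Implicit.
Unset Printing Implicit Defensive.

Import Order.TTheory GRing.Theory Num.Theory numFieldNormedType.Exports.
Local Open Scope classical_set_scope.
Local Open Scope ring_scope.
Local Open Scope sesquilinear_scope.
Local Open Scope complex_scope.

(** Writing the real and imaginary parts of the entries of a matrix as real
    coordinates, the unitary group is a closed subset of a product of segments
    [-1, 1], hence compact by Tychonoff, and the product of the normalized grand
    sums is continuous in these coordinates, hence attains its maximum. Since
    the grand sums are nonnegative, the extended logarithm turns the geometric
    mean into minus the average rugosity, and being increasing it exchanges the
    maximum with the minimum. *)

(** * Continuity of complex and matrix functions through real and imaginary parts *)

Section complex_continuity.
Variables (R : realType) (T : topologicalType).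
Implicit Types f g : T -> R[i].

(** Complex continuity is expressed by two real functions, so that only the topology of [R] is
    involved. *)
Definition ccontinuous f :=
  continuous (fun x => complex.Re (f x)) /\
  continuous (fun x => complex.Im (f x)).

Definition mxcontinuous m n (F : T -> 'M[R[i]]_(m, n)) :=
  forall i j, ccontinuous (fun x => F x i j).

Lemma ccontinuous_cst c : ccontinuous (fun=> c).
Proof. by split=> x; exact: cvg_cst. Qed.

Lemma ReD (z w : R[i]) :
  complex.Re (z + w) = complex.Re z + complex.Re w.
Proof. by case: z w => [a b] [c d]. Qed.

Lemma ImD (z w : R[i]) :
  complex.Im (z + w) = complex.Im z + complex.Im w.
Proof. by case: z w => [a b] [c d]. Qed.

Lemma ccontinuousD f g :
  ccontinuous f -> ccontinuous g -> ccontinuous (fun x => f x + g x).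
Proof.
move=> [fR fI] [gR gI]; split=> x.
- under eq_fun do rewrite ReD.
  by apply: cvgD; [exact: fR|exact: gR].
- under eq_fun do rewrite ImD.
  by apply: cvgD; [exact: fI|exact: gI].
Qed.

Lemma ReM (z w : R[i]) : complex.Re (z * w) =
  complex.Re z * complex.Re w - complex.Im z * complex.Im w.
Proof. by case: z w => [a b] [c d]. Qed.

Lemma ImM (z w : R[i]) : complex.Im (z * w) =
  complex.Re z * complex.Im w + complex.Im z * complex.Re w.
Proof. by case: z w => [a b] [c d]. Qed.

Lemma ccontinuousM f g :
  ccontinuous f -> ccontinuous g -> ccontinuous (fun x => f x * g x).
Proof.
move=> [fR fI] [gR gI]; split=> x.
- under eq_fun do rewrite ReM.
  by apply: cvgB; apply: cvgM;
     [exact: fR|exact: gR|exact: fI|exact: gI].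
- under eq_fun do rewrite ImM.
  by apply: cvgD; apply: cvgM;
     [exact: fR|exact: gI|exact: fI|exact: gR].
Qed.

Lemma Re_conjC (z : R[i]) : complex.Re (Num.conj z) = complex.Re z.
Proof. by case: z. Qed.

Lemma Im_conjC (z : R[i]) : complex.Im (Num.conj z) = - complex.Im z.
Proof. by case: z. Qed.

Lemma ccontinuous_conj f :
  ccontinuous f -> ccontinuous (fun x => Num.conj (f x)).
Proof.
move=> [fR fI]; split=> x.
- by under eq_fun do rewrite Re_conjC; exact: fR.
- by under eq_fun do rewrite Im_conjC; apply: cvgN; exact: fI.
Qed.

Lemma ccontinuous_sum (I : Type) (r : seq I) (F : I -> T -> R[i]) :
  (forall i, ccontinuous (F i)) ->
  ccontinuous (fun x => \sum_(i <- r) F i x).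
Proof.
move=> Fc; elim: r => [|i r IH].
  by under eq_fun do rewrite big_nil; exact: ccontinuous_cst.
by under eq_fun do rewrite big_cons; exact: ccontinuousD.
Qed.

Lemma continuous_prod (I : Type) (r : seq I) (F : I -> T -> R) :
  (forall i, continuous (F i)) ->
  continuous (fun x => \prod_(i <- r) F i x).
Proof.
move=> Fc x; apply: cvg_big => [|i _]; first exact: mul_continuous.
exact: Fc.
Qed.

Lemma mxcontinuous_cst (m n : nat) (A : 'M[R[i]]_(m, n)) : mxcontinuous (fun=> A).
Proof. by move=> i j; exact: ccontinuous_cst. Qed.

Lemma mxcontinuousM (m n p : nat) (F : T -> 'M[R[i]]_(m, n)) (G : T -> 'M[R[i]]_(n, p)) :
  mxcontinuous F -> mxcontinuous G -> mxcontinuous (fun x => F x *m G x).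
Proof.
move=> Fc Gc i j; under eq_fun do rewrite mxE.
by apply: ccontinuous_sum => k; exact: ccontinuousM.
Qed.

Lemma mxcontinuous_trmxC (m n : nat) (F : T -> 'M[R[i]]_(m, n)) :
  mxcontinuous F -> mxcontinuous (fun x => (F x)^t*).
Proof.
by move=> Fc i j; under eq_fun do rewrite !mxE; exact: ccontinuous_conj.
Qed.

(** A matrix equation is a family of real equations, two for each entry, and each cuts out the
    preimage of a closed point of [R]. *)
Lemma closed_mx_eq (m n : nat) (F : T -> 'M[R[i]]_(m, n)) (A : 'M[R[i]]_(m, n)) :
  mxcontinuous F -> closed [set x | F x = A].
Proof.
move=> Fc.
have -> : [set x | F x = A] = \bigcap_(ij in [set: 'I_m * 'I_n])
  ((fun x => complex.Re (F x ij.1 ij.2)) @^-1`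
     [set t | t = complex.Re (A ij.1 ij.2)] `&`
   (fun x => complex.Im (F x ij.1 ij.2)) @^-1`
     [set t | t = complex.Im (A ij.1 ij.2)]).
  apply/seteqP; split=> x /= FA; first by move=> ij _ /=; rewrite FA.
  apply/matrixP => i j; have [/= FR FI] := FA (i, j) Logic.I.
  by apply/eqP; rewrite eq_complex FR FI !eqxx.
apply: closed_bigI => -[i j] _ /=; have [FR FI] := Fc i j.
by apply: closedI; apply: preimage_closed.
Qed.

End complex_continuity.

(** * Compactness of the unitary group in real coordinates *)

Section unitary_group.
Variables (R : realType) (D : nat).

(** The boolean selects the real part ([true]) or the imaginary part ([false]) of an entry. *)
Definition mx_coordinates : topologicalType :=
  prod_topology (fun _ : 'I_D * 'I_D * bool => R : topologicalType).

Definition mx_of_coordinates (x : mx_coordinates) : 'M[R[i]]_D :=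
  \matrix_(i, j) (x (i, j, true) +i* x (i, j, false)).

Definition coordinates_of_mx (U : 'M[R[i]]_D) : mx_coordinates :=
  fun k => if k.2 then complex.Re (U k.1.1 k.1.2)
           else complex.Im (U k.1.1 k.1.2).

Lemma coordinates_of_mxK : cancel coordinates_of_mx mx_of_coordinates.
Proof.
move=> U; apply/matrixP => i j; rewrite mxE /coordinates_of_mx/=.
by case: (U i j).
Qed.

Lemma mxcontinuous_coordinates : mxcontinuous mx_of_coordinates.
Proof.
move=> i j; split=> x.
- under eq_fun do rewrite mxE/=.
  exact: (@proj_continuous _ (fun=> R : topologicalType)
    (i, j, true)).
- under eq_fun do rewrite mxE/=.
  exact: (@proj_continuous _ (fun=> R : topologicalType)
    (i, j, false)).
Qed.

(** The diagonal entry [(i, i)] of [U *m U^t* = 1] says that the squared moduli along row [i] add up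
    to 1, and each of them is nonnegative. *)
Lemma unitarymx_entry_le1 (U : 'M[R[i]]_D) i j : U \is unitarymx ->
  complex.Re (U i j) ^+ 2 + complex.Im (U i j) ^+ 2 <= 1.
Proof.
move=> /unitarymxP /matrixP /(_ i i) /(congr1 (@complex.Re R)).
rewrite !mxE eqxx (big_morph _ (@ReD R) erefl) /= => UE.
rewrite -[leRHS]UE (bigD1 j)//= !mxE.
have E (z : R[i]) : complex.Re (z * Num.conj z) =
    complex.Re z ^+ 2 + complex.Im z ^+ 2.
  by rewrite ReM Re_conjC Im_conjC mulrN opprK -!expr2.
rewrite E lerDl; apply: sumr_ge0 => k _; rewrite !mxE E.
by rewrite addr_ge0 ?sqr_ge0.
Qed.

Lemma compact_unitary_coordinates :
  compact [set x | mx_of_coordinates x \is unitarymx].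
Proof.
apply: (@subclosed_compact _ _
  [set x : mx_coordinates | forall k, `[-1, 1]%classic (x k)]).
- rewrite (_ : [set _ | _] = [set x |
    mx_of_coordinates x *m (mx_of_coordinates x)^t* = 1%:M]).
    apply: closed_mx_eq; apply: mxcontinuousM;
      [|apply: mxcontinuous_trmxC]; exact: mxcontinuous_coordinates.
  by apply/seteqP; split=> x /unitarymxP.
- apply: (@tychonoff _ (fun=> R : topologicalType)
    (fun=> `[-1, 1]%classic)) => k.
  exact: segment_compact.
- move=> x /= xU [[i j] b].
  have := unitarymx_entry_le1 i j xU; rewrite mxE/=.
  set s := x (i, j, true); set t := x (i, j, false) => st.
  (* Squaring reduces the bound on the absolute value to the previous one, where the square of the
     coordinate is one of two nonnegative summands. *)
  rewrite in_itv/= -ler_norml -(@ler_pXn2r _ 2)// ?nnegrE//.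
  rewrite expr1n real_normK ?num_real//.
  apply: le_trans st.
  by case: b; rewrite -/s -/t (lerDl, lerDr) sqr_ge0.
Qed.

(** As every matrix has coordinates, a maximizer in coordinates is one over the whole group; the
    identity shows that the group is nonempty. *)
Lemma unitary_EVT_max (f : 'M[R[i]]_D -> R) :
  continuous (f \o mx_of_coordinates) ->
  exists2 U0, U0 \is unitarymx & forall U, U \is unitarymx -> f U <= f U0.
Proof.
move=> fc.
have [|||c] := @compact_EVT_max _ _ (f \o mx_of_coordinates)
  [set x | mx_of_coordinates x \is unitarymx].
- exists (coordinates_of_mx 1%:M) => /=; rewrite coordinates_of_mxK.
  by apply/unitarymxP; rewrite mul1mx trmx1 map_mx1.
- exact: compact_unitary_coordinates.
- exact: continuous_subspaceT.
- rewrite inE /= => cU cmax; exists (mx_of_coordinates c) => // U UU.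
  have := cmax (coordinates_of_mx U); rewrite inE /= coordinates_of_mxK.
  exact.
Qed.

Lemma continuous_grand_sum (rho : 'M[R[i]]_D) :
  continuous (fun x => grand_sum (mx_of_coordinates x) rho).
Proof.
have Bc : mxcontinuous (fun x => (f1 R D)^t* *m
    (mx_of_coordinates x *m rho *m (mx_of_coordinates x)^t*) *m f1 R D).
  apply: mxcontinuousM; last exact: mxcontinuous_cst.
  apply: mxcontinuousM; first exact: mxcontinuous_cst.
  apply: mxcontinuousM; last first.
    by apply: mxcontinuous_trmxC; exact: mxcontinuous_coordinates.
  apply: mxcontinuousM; last exact: mxcontinuous_cst.
  exact: mxcontinuous_coordinates.
have [Rc _] := Bc 0 0.
by move=> x; exact: cvgM (cvg_cst (D%:R : R)) (Rc x).
Qed.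

End unitary_group.

(** * Extended logarithm of products and powers *)

Section log_of_means.
Variable R : realType.

(** A vanishing factor makes both sides [-oo], since [-oo] absorbs every summand; otherwise this is
    the usual rule for positive reals. *)
Lemma lne_prod (I : Type) (r : seq I) (F : I -> R) :
  (forall i, 0 <= F i) ->
  (lne (\prod_(i <- r) F i)%:E = \sum_(i <- r) lne (F i)%:E)%E.
Proof.
move=> F0; elim: r => [|i r IH]; first by rewrite !big_nil lne1.
rewrite !big_cons -IH; have := F0 i.
have P0 : 0 <= \prod_(j <- r) F j by exact: prodr_ge0.
rewrite le0r => /predU1P[->|Fi].
  by rewrite mul0r /= lexx.
move: P0; rewrite le0r => /predU1P[->|P0].
  by rewrite mulr0 /= lexx addeNy.
by rewrite EFinM lneM// in_itv/= lte_fin ?Fi ?P0 leey.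
Qed.

Lemma lne_powR (x p : R) : 0 <= x -> 0 < p ->
  (lne (x `^ p)%:E = p%:E * lne x%:E)%E.
Proof.
rewrite le0r => /predU1P[->|x0] p0.
  by rewrite powR0 ?gt_eqF//= lexx gt0_muleNy.
by rewrite !lne_EFin ?powR_gt0// ln_powR.
Qed.

(** The logarithm of a finite number is never [+oo], so no sum [+oo - oo] arises when an opposite is
    moved through a sum of logarithms. *)
Lemma lne_adde_def (x y : R) : (lne x%:E +? lne y%:E)%E.
Proof. by rewrite /lne; case: ifP; case: ifP. Qed.

End log_of_means.

Theorem proposition3 (R : realType) (D N : nat) (N_ge1 : (1 <= N)%N)
    (S : 'I_N -> 'M[R[i]]_D)
    (S_density : forall a : 'I_N, density_operator (S a)) :
  [/\ (* the maximum defining the geometric rugosity exists *)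
      exists2 U0 : 'M[R[i]]_D, U0 \is unitarymx &
        forall U : 'M[R[i]]_D, U \is unitarymx ->
          geometric_mean S U <= geometric_mean S U0,
      (* the minimum of the average rugosity exists *)
      exists2 U0 : 'M[R[i]]_D, U0 \is unitarymx &
        forall U : 'M[R[i]]_D, U \is unitarymx ->
          (average_rugosity S U0 <= average_rugosity S U)%E &
      geometric_rugosity S =
        ereal_inf [set average_rugosity S U | U in unitaries R D]].
Proof.
have q_ge0 U a : 0 <= grand_sum U (S a) / D%:R.
  by have [_ ?] := grand_sumE U (S_density a); rewrite divr_ge0.
have Ninv_gt0 : 0 < (N%:R^-1 : R) by rewrite invr_gt0 ltr0n.
(* This identity holds for each [U] separately, including when some grand sum vanishes and both
   sides are [+oo]. *)
have avgE U : average_rugosity S U = (- lne (geometric_mean S U)%:E)%E.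
  rewrite /average_rugosity /rugosity lne_powR//; last exact: prodr_ge0.
  rewrite lne_prod// -muleN; congr (_ * _)%E.
  apply: sumeN => a b _ _.
  exact: lne_adde_def.
have [U0 U0U U0max] : exists2 U0, U0 \is unitarymx &
    forall U, U \is unitarymx -> geometric_mean S U <= geometric_mean S U0.
  (* The product is maximized first; the power [N%:R^-1] is nondecreasing on nonnegative reals, so
     the same [U0] maximizes the geometric mean. *)
  have [|U0 U0U U0max] := @unitary_EVT_max R D
    (fun U => \prod_(a < N) (grand_sum U (S a) / D%:R)).
    apply: continuous_prod => a x.
    exact: cvgM (@continuous_grand_sum R D (S a) x) (cvg_cst (D%:R^-1 : R)).
  exists U0; [exact: U0U|move=> U /U0max le_prod].
  by apply: ge0_ler_powR le_prod; [exact: ltW|exact: prodr_ge0..].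
have U0min U : U \is unitarymx ->
    (average_rugosity S U0 <= average_rugosity S U)%E.
  move=> UU; rewrite !avgE leeN2 lee_lne ?lee_fin ?U0max//.
  - by rewrite in_itv/= lee_fin powR_ge0 leey.
  - by rewrite in_itv/= lee_fin powR_ge0 leey.
split; [by exists U0|by exists U0|].
(* The maximizer provides both the nonemptiness and the upper bound that make [sup] meaningful
   here. *)
have supE : sup [set geometric_mean S U | U in unitaries R D] =
    geometric_mean S U0.
  apply/eqP; rewrite eq_le; apply/andP; split.
    apply: ge_sup; first by exists (geometric_mean S U0), U0.
    by move=> _ [U /U0max ? <-].
  apply: ub_le_sup; last by exists U0.
  by exists (geometric_mean S U0) => _ [U /U0max ? <-].
rewrite /geometric_rugosity supE -avgE.
(* The infimum is attained at the same [U0]. *)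
apply/eqP; rewrite eq_le; apply/andP; split.
  by apply: le_ereal_inf_tmp => _ [U /U0min ? <-].
by apply: ereal_inf_lbound; exists U0.
Qed.
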